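(* Let $\rho_{\mathbf x}$ and $\rho_{\mathbf y}$ be stationary ergodic processes with alphabet $A$, and let $\mathbf x=(X_1,\dots,X_k)$ and $\mathbf y=(Y_1,\dots,Y_m)$ be the initial segments of sequences $X_1,X_2,\dots$ and $Y_1,Y_2,\dots$ whose distributions are $\rho_{\mathbf x}$ and $\rho_{\mathbf y}$ respectively. Then (i) $\lim_{k,m\to\infty}\hat d(\mathbf x,\mathbf y)=d(\rho_{\mathbf x},\rho_{\mathbf y})$ almost surely; (ii) $\lim_{k\to\infty}\hat d(\mathbf x,\rho_{\mathbf y})=d(\rho_{\mathbf x},\rho_{\mathbf y})$ almost surely.
   Context: The alphabet $A$ is $\mathbb R$ or a finite set. $\mathcal B_n$ is the Borel sigma-algebra of $A^n$, $\mathcal B_\infty$ that of $A^\infty$, and $\mathcal B=\bigcup_{n\ge1}\mathcal B_n$ (finite-time events; $B\in\mathcal B_n$ is identified with the event that the first $n$ coordinates fall in $B$). A process is a probability measure on $(A^\infty,\mathcal B_\infty)$. For $\mathbf x=X_{1..n}\in A^n$ and measurable $B\subset A^k$, the frequency is $\nu(\mathbf x,B):=\frac1{n-k+1}\sum_{i=1}^{n-k+1}\mathbf 1\{(X_i,\dots,X_{i+k-1})\in B\}$ if $n\ge k$, and $\nu(\mathbf x,B):=0$ otherwise. A process $\rho$ is stationary if $\rho(X_{1..j}\in B)=\rho(X_{i..i+j-1}\in B)$ for all $i,j\ge 1$ and measurable $B\subset A^j$. It is ergodic if for every $B\in\mathcal B$ there is a constant $v_B$ with $\lim_{n\to\infty}\nu(X_{1..n},B)=v_B$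 with $\rho$-probability 1; it is stationary ergodic if it is both. Fix a sequence $(B_i)_{i\in\mathbb N}$ of sets in $\mathcal B$ that generates $\mathcal B_\infty$ and positive reals $(w_i)_{i\in\mathbb N}$ with $\sum_i w_i=1$ (for instance $w_i=1/(i(i+1))$). The distributional distance is $d(\rho_1,\rho_2):=\sum_{i=1}^\infty w_i|\rho_1(B_i)-\rho_2(B_i)|$. Its empirical versions are $\hat d(\mathbf x,\mathbf y):=\sum_{i=1}^\infty w_i|\nu(\mathbf x,B_i)-\nu(\mathbf y,B_i)|$ and $\hat d(\mathbf x,\rho):=\sum_{i=1}^\infty w_i|\nu(\mathbf x,B_i)-\rho(B_i)|$. In (i), the limit is taken as $k$ and $m$ both tend to infinity, jointly and arbitrarily. *)

(* Defs.v *)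
From HB Require Import structures.
From mathcomp Require Export all_boot all_order all_algebra.
From mathcomp Require Export all_classical all_reals all_analysis.
Export numFieldNormedType.Exports.

Set Implicit Arguments.
Unset Strict Implicit.
Unset Printing Implicit Defensive.

Import Order.TTheory GRing.Theory Num.Theory.

Local Open Scope classical_set_scope.
Local Open Scope ring_scope.

(* The pointed structure is only there because measurable types are pointed;
   it excludes no alphabet but the empty one, which carries no process. *)
Definition is_alphabet (R : realType) (A : ptopologicalType) : Prop :=
  A = (R : ptopologicalType) \/
  (finite_set [set: A] /\ forall U : set A, open U).

(* Indices start at 0: the letter X_i is X (i - 1). *)
Definition word (A : ptopologicalType) (n : nat) :=
  g_sigma_algebraType (@open (prod_topology (fun _ : 'I_n => A))).

Definition path_space (A : ptopologicalType) :=
  g_sigma_algebraType (@open (prod_topology (fun _ : nat => A))).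

Notation process R A := (probability (path_space A) R).

(* X_{i+1}, ..., X_{i+j} *)
Definition block (A : ptopologicalType) (X : path_space A) (i j : nat) :
  word A j := fun t => X (i + t)%N.
Arguments block {A} X i j.

Definition initseg (A : ptopologicalType) (X : path_space A) (n : nat) :
  word A n := block X 0 n.
Arguments initseg {A} X n.

(* Finite-time events carry their length, since the frequency depends on it. *)
Record ftevent (A : ptopologicalType) := FTEvent {
  evlen : nat;
  evlen_gt0 : (0 < evlen)%N;
  evset : set (word A evlen);
  measurable_evset : measurable evset
}.
Arguments evset {A} f.
Arguments measurable_evset {A} f.

Definition cylinder (A : ptopologicalType) (B : ftevent A) :
  set (path_space A) := [set X | evset B (initseg X (evlen B))].

Lemma window_subproof (n k : nat) (i : 'I_(n.+1 - k)) (t : 'I_k) :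
  (i + t < n)%N.
Proof.
have := ltn_ord i; rewrite ltn_subRL addnC ltnS => ikn.
by apply: leq_trans ikn; rewrite ltn_add2l.
Qed.

Definition window (A : ptopologicalType) (n k : nat) (x : word A n)
  (i : 'I_(n.+1 - k)) : word A k := fun t => x (Ordinal (window_subproof i t)).
Arguments window {A n k} x i.

Definition freq (R : realType) (A : ptopologicalType) (n k : nat)
    (x : word A n) (B : set (word A k)) : R :=
  if (k <= n)%N then
    (n.+1 - k)%:R^-1 * \sum_(i < n.+1 - k) \1_B (window x i)
  else 0.
Arguments freq R {A n k} x B.

Section Processes.
Variables (R : realType) (A : ptopologicalType).
Implicit Type rho : process R A.

Definition stationary rho : Prop :=
  forall (i j : nat) (B : set (word A j)), (0 < j)%N -> measurable B ->
    rho [set X | B (block X 0 j)] = rho [set X | B (block X i j)].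

Definition ergodic rho : Prop :=
  forall B : ftevent A, exists v : R,
    {ae rho, forall X, freq R (initseg X n) (evset B) @[n --> \oo] --> v}.

Definition stationary_ergodic rho : Prop := stationary rho /\ ergodic rho.

End Processes.

Definition generates (A : ptopologicalType) (B : nat -> ftevent A) : Prop :=
  <<s range (fun i => cylinder (B i)) >> =
  (measurable : set (set (path_space A))).

Definition weights (R : realType) (w : nat -> R) : Prop :=
  (forall i, 0 < w i) /\ series w @ \oo --> (1 : R).

Section Distances.
Variables (R : realType) (A : ptopologicalType).
Variables (B : nat -> ftevent A) (w : nat -> R).

Definition ddist (rho1 rho2 : process R A) : R :=
  limn (series (fun i =>
    w i * `|fine (rho1 (cylinder (B i))) - fine (rho2 (cylinder (B i)))|)).

Definition dhat (n m : nat) (x : word A n) (y : word A m) : R :=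
  limn (series (fun i =>
    w i * `|freq R x (evset (B i)) - freq R y (evset (B i))|)).

Definition dhat_process (n : nat) (x : word A n) (rho : process R A) : R :=
  limn (series (fun i =>
    w i * `|freq R x (evset (B i)) - fine (rho (cylinder (B i)))|)).

End Distances.

Definition has_distribution d (Omega : measurableType d) (R : realType)
    (A : ptopologicalType) (P : probability Omega R)
    (X : {RV P >-> path_space A}) (rho : process R A) : Prop :=
  forall E : set (path_space A), measurable E -> distribution P X E = rho E.

(* Main.v *)
Require Import Defs.
From mathcomp Require Import measurable_realfun ring lra.

(** Stationarity makes the expected frequency of an event [B] along a sample of
    [rho] equal to [rho B] as soon as the sample is at least as long as [B]
    (integral_freq).  Ergodicity makes the frequency converge almost surely to
    a constant; frequencies lie in [0, 1], so by dominated convergence the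
    expectations converge to that constant, which is therefore [rho B]
    (freq_cvg_ae).

    There are countably many events [B_i], so almost surely all the
    frequencies of the sequence [X], and all those of [Y], converge at once.
    From there on the argument is deterministic: the [i]-th term of the series
    defining the distances is at most [w_i] whatever the samples, and the
    [w_i] are summable, so the limit passes through the infinite sum
    (cvg_lim_series_dominated).  This last step holds along an arbitrary
    filter, which covers both the joint limit in the two sample sizes and the
    limit in a single one.

    Almost sure statements about a law are carried over to the probability
    space on which [X] and [Y] live by ae_distribution. *)

Set Implicit Arguments.
Unset Strict Implicit.
Unset Printing Implicit Defensive.

Import Order.TTheory GRing.Theory Num.Theory.

Local Open Scope classical_set_scope.
Local Open Scope ring_scope.

(** * Exchanging a limit with a dominated series *)

Lemma dist_lim_series_le (R : realType) (h w : nat -> R) (n : nat) (e : R) :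
  cvgn (series w) -> (forall i, `|h i| <= w i) ->
  (forall m, (n <= m)%N -> `|\sum_(n <= k < m) w k| <= e) ->
  `|limn (series h) - series h n| <= e.
Proof.
move=> cw hw we.
have ch : cvgn (series h).
  apply: normed_cvg; apply: (series_le_cvg _ _ hw) => // i.
  exact: le_trans (hw i).
have cd : `|series h m - series h n| @[m --> \oo] -->
    `|limn (series h) - series h n|.
  by apply: cvg_norm; apply: cvgB => //; exact: cvg_cst.
rewrite -(cvg_lim (@Rhausdorff R) cd); apply: limr_le.
  by apply/cvg_ex; eexists; exact: cd.
near=> m.
have nm : (n <= m)%N by near: m; exact: nbhs_infty_ge.
rewrite sub_series_geq// (le_trans _ (we _ nm))// (le_trans (ler_norm_sum _ _ _))//.
by rewrite (le_trans _ (ler_norm _))// ler_sum.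
Unshelve. all: by end_near. Qed.

(** Tannery's theorem along an arbitrary filter: the tails are small uniformly
    in the parameter, since they are bounded by those of [w], and the remaining
    finite sum converges term by term. *)
Lemma cvg_lim_series_dominated (R : realType) (T : Type) (F : set_system T)
    (FF : Filter F) (f : T -> nat -> R) (g w : nat -> R) :
  cvgn (series w) -> (forall t i, `|f t i| <= w i) ->
  (forall i, `|g i| <= w i) ->
  (forall i, f t i @[t --> F] --> g i) ->
  limn (series (f t)) @[t --> F] --> limn (series g).
Proof.
move=> cw fw gw fg; apply/cvgrPdist_le => e e0.
have e3 : 0 < e / 3 by rewrite divr_gt0.
(* The cut-off comes from [w] alone, so it serves every [f t] and [g]. *)
have [n we] : exists n, forall m, (n <= m)%N -> `|\sum_(n <= k < m) w k| <= e / 3.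
  have /cauchy_seriesP/(_ _ e3) [[P Q] [[n1 _ n1P] [n2 _ n2Q]] PQ] :
    cauchy (series w @ \oo) by exact: cvg_cauchy.
  exists (maxn n1 n2) => m nm; apply/ltW/(PQ (maxn n1 n2, m)); split => /=.
    by apply: n1P; exact: leq_maxl.
  by apply: n2Q; rewrite /= (leq_trans _ nm) ?leq_maxr.
have sfg : series (f t) n @[t --> F] --> series g n.
  apply: cvg_big => [|i _]; last exact: fg.
  exact: add_continuous.
near=> t.
have -> : limn (series g) - limn (series (f t)) =
  (limn (series g) - series g n) + (series g n - series (f t) n) -
  (limn (series (f t)) - series (f t) n) by ring.
have -> : e = e / 3 + e / 3 + e / 3 by field.
apply: (le_trans (ler_normB _ _)); apply: lerD; last first.
  exact: dist_lim_series_le cw (fw t) we.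
apply: (le_trans (ler_normD _ _)); apply: lerD.
  exact: dist_lim_series_le cw gw we.
by near: t; move/cvgrPdist_le : sfg; apply.
Unshelve. all: by end_near. Qed.

Lemma normB_le1 (R : realType) (a b : R) :
  0 <= a <= 1 -> 0 <= b <= 1 -> `|a - b| <= 1.
Proof. by move=> /andP[? ?] /andP[? ?]; rewrite ler_norml; lra. Qed.

(** All four families lie in [0, 1], so the distances are at most 1 and the
    weights dominate the terms. *)
Lemma cvg_weighted_dist (R : realType) (w : nat -> R) (T : Type)
    (F : set_system T) (FF : Filter F) (a b : T -> nat -> R) (p q : nat -> R) :
  weights w ->
  (forall t i, 0 <= a t i <= 1) -> (forall t i, 0 <= b t i <= 1) ->
  (forall i, 0 <= p i <= 1) -> (forall i, 0 <= q i <= 1) ->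
  (forall i, a t i @[t --> F] --> p i) ->
  (forall i, b t i @[t --> F] --> q i) ->
  limn (series (fun i => w i * `|a t i - b t i|)) @[t --> F] -->
  limn (series (fun i => w i * `|p i - q i|)).
Proof.
move=> [w0 w1] a01 b01 p01 q01 ap bq.
have dom x y i : 0 <= x <= 1 -> 0 <= y <= 1 -> `|w i * `|x - y| | <= w i.
  move=> x01 y01; rewrite normrM normr_id gtr0_norm// ler_piMr//; first exact: ltW.
  exact: normB_le1.
apply: (@cvg_lim_series_dominated _ _ _ _ _ _ w).
- by apply/cvg_ex; exists 1.
- by move=> t i; exact: dom.
- by move=> i; exact: dom.
- move=> i; apply: cvgM; first exact: cvg_cst.
  by apply: cvg_norm; exact: cvgB.
Qed.

(** * Frequencies along a stationary ergodic process *)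

Section Frequencies.
Variables (R : realType) (A : ptopologicalType).

Lemma continuous_block (i j : nat) :
  continuous ((fun X t => X (i + t)%N) :
    prod_topology (fun _ : nat => A) -> prod_topology (fun _ : 'I_j => A)).
Proof.
move=> X; apply/cvg_sup => t; move: X.
apply/(@continuousP _ (initial_topology (@^~ t))) => _ [U oU <-].
apply: (iffLR (@continuousP (prod_topology (fun _ : nat => A)) A _) _ _ oU).
exact: (@proj_continuous nat (fun=> A) (i + t)%N).
Qed.

(** Both sigma-algebras are generated by the open sets of a product topology,
    so measurability of a block follows from its continuity. *)
Lemma measurable_block (i j : nat) :
  measurable_fun [set: path_space A]
    (fun X : path_space A => block X i j).
Proof.
apply: (@measurability _ _ _ (word A j) _ _
  (@open (prod_topology (fun _ : 'I_j => A)))) => //.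
move=> _ [U oU <-]; rewrite setTI; apply: sub_sigma_algebra.
exact: (iffLR (continuousP _) (@continuous_block i j) _ oU).
Qed.

Definition shifted_event (B : ftevent A) (i : nat) : set (path_space A) :=
  [set X | evset B (block X i (evlen B))].

Lemma measurable_shifted_event (B : ftevent A) (i : nat) :
  measurable (shifted_event B i).
Proof.
rewrite -[shifted_event B i]setTI.
exact: measurable_block (measurable_evset B).
Qed.

Lemma freq_initseg (B : ftevent A) (X : path_space A) (n : nat) :
  (evlen B <= n)%N ->
  freq R (initseg X n) (evset B) = (n.+1 - evlen B)%:R^-1 *
    \sum_(i < n.+1 - evlen B) \1_(shifted_event B i) X.
Proof. by move=> Bn; rewrite /freq Bn. Qed.

Lemma freq_itv (n k : nat) (x : word A n) (B : set (word A k)) :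
  0 <= freq R x B <= 1.
Proof.
rewrite /freq; case: ifPn => [kn|_]; last by rewrite lexx ler01.
have n0 : 0 < (n.+1 - k)%:R :> R by rewrite ltr0n subn_gt0 ltnS.
rewrite mulr_ge0 ?invr_ge0 ?ler0n//=; last by apply: sumr_ge0.
rewrite ler_pdivrMl// mulr1.
rewrite -[leRHS](_ : \sum_(i < n.+1 - k) 1 = _); last first.
  by rewrite sumr_const card_ord.
by apply: ler_sum => i _; rewrite indicE lern1 leq_b1.
Qed.

Lemma measurable_freq (B : ftevent A) (n : nat) :
  measurable_fun [set: path_space A]
    (fun X => freq R (initseg X n) (evset B)).
Proof.
have [Bn|nB] := leqP (evlen B) n; last first.
  by rewrite /freq leqNgt nB /=; exact: measurable_cst.
rewrite (_ : (fun _ => _) = fun X => (n.+1 - evlen B)%:R^-1 *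
    \sum_(i < n.+1 - evlen B) \1_(shifted_event B i) X); last first.
  by apply/funext => X; exact: freq_initseg.
apply: measurable_funM; first exact: measurable_cst.
apply: measurable_sum => i; apply: measurable_indic.
exact: measurable_shifted_event.
Qed.

(** By stationarity each of the windows has the same probability of falling in
    [B], so their average does too. *)
Lemma integral_freq (rho : process R A) (B : ftevent A) (n : nat) :
  stationary rho -> (evlen B <= n)%N ->
  (\int[rho]_X (freq R (initseg X n) (evset B))%:E = rho (cylinder B))%E.
Proof.
move=> st Bn.
under eq_integral do rewrite freq_initseg// EFinM -sumEFin.
have mE i := measurable_shifted_event B i.
have mI i : measurable_fun setT (fun X => (\1_(shifted_event B i) X)%:E : \bar R).
  by apply/measurable_EFinP; exact: measurable_indic.
rewrite ge0_integralZl//; first last.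
- by move=> X _; apply: sume_ge0 => i _; rewrite lee_fin.
- exact: emeasurable_sum.
rewrite ge0_integral_sum//.
have rhoE i : rho (shifted_event B i) = rho (cylinder B).
  exact: esym (st i _ _ (evlen_gt0 B) (measurable_evset B)).
rewrite (eq_bigr (fun=> rho (cylinder B))) => [|i _]; last first.
  by rewrite integral_indic// setIT; exact: rhoE.
have -> : rho (cylinder B) = (fine (rho (cylinder B)))%:E.
  by rewrite fineK// fin_num_measure//; exact: (measurable_shifted_event B 0).
rewrite sumEFin sumr_const card_ord -EFinM -[X in _ * X]mulr_natl mulrA.
rewrite mulVf ?mul1r//.
by rewrite pnatr_eq0 -lt0n subn_gt0 ltnS.
Qed.

(** Ergodicity only asserts that the limit is some constant; dominated
    convergence identifies it from the expectations. *)
Lemma freq_cvg_ae (rho : process R A) (B : ftevent A) :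
  stationary_ergodic rho ->
  {ae rho, forall X, freq R (initseg X n) (evset B) @[n --> \oo] -->
    fine (rho (cylinder B))}.
Proof.
move=> [st /(_ B)[v rv]].
suff -> : fine (rho (cylinder B)) = v by [].
pose f n (X : path_space A) := (freq R (initseg X n) (evset B))%:E.
have [_ _] : [/\ rho.-integrable setT (cst v%:E),
    (\int[rho]_x `|f n x - (cst v%:E) x|)%E @[n --> \oo] --> 0%E &
    (\int[rho]_x f n x)%E @[n --> \oo] --> (\int[rho]_x (cst v%:E) x)%E].
  apply: (@dominated_convergence _ _ _ _ _ _ _ _ (cst 1%E)) => //.
  - by move=> n; apply/measurable_EFinP; exact: measurable_freq.
  - apply: filterS rv => X fv _; apply: cvg_EFin => //; exact: nearW.
  - exact: finite_measure_integrable_cst.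
  - apply: aeW => X n _; rewrite /f /= lee_fin.
    by have /andP[f0 f1] := freq_itv (initseg X n) (evset B); rewrite ger0_norm.
have -> : (\int[rho]_x (cst v%:E) x = v%:E)%E.
  rewrite integral_cst//.
  by have := @probability_setT _ _ _ rho => /= ->; rewrite mule1.
move=> If.
suff -> : rho (cylinder B) = v%:E by [].
(* The sequence of expectations is constant once [n >= evlen B]. *)
apply: cvg_unique If => //.
apply: cvg_near_cst; near=> n; apply: integral_freq => //.
by near: n; exact: nbhs_infty_ge.
Unshelve. all: by end_near. Qed.

(** The set where [Q] fails may be non-measurable, so what is pulled back along
    [X] is a measurable null set containing it. *)
Lemma ae_distribution d (Omega : measurableType d) (P : probability Omega R)
    (X : {RV P >-> path_space A}) (rho : process R A)
    (Q : path_space A -> Prop) :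
  has_distribution X rho -> {ae rho, forall x, Q x} ->
  {ae P, forall omega, Q (X omega)}.
Proof.
move=> dX [N [mN N0 QN]]; exists (X @^-1` N); split.
- by rewrite -[X @^-1` N]setTI; exact: measurable_funPT.
- by rewrite -N0 -dX.
- by move=> omega nQ; exact: QN.
Qed.

End Frequencies.

(** * Consistency of the empirical distributional distances *)

Theorem lemma3p1 (R : realType) (A : ptopologicalType)
  (alphabetA : is_alphabet R A)
  (B : nat -> ftevent A) (genB : generates B)
  (w : nat -> R) (w_weights : weights w)
  (rhox rhoy : process R A)
  (rhox_se : stationary_ergodic rhox) (rhoy_se : stationary_ergodic rhoy)
  (d : measure_display) (Omega : measurableType d) (P : probability Omega R)
  (X Y : {RV P >-> path_space A})
  (distX : has_distribution X rhox) (distY : has_distribution Y rhoy) :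
  {ae P, forall omega,
    dhat B w (initseg (X omega) km.1) (initseg (Y omega) km.2)
      @[km --> (\oo, \oo)] --> ddist B w rhox rhoy} /\
  {ae P, forall omega,
    dhat_process B w (initseg (X omega) k) rhoy
      @[k --> \oo] --> ddist B w rhox rhoy}.
Proof.
have freqs (rho : process R A) (Z : {RV P >-> path_space A}) :
    stationary_ergodic rho -> has_distribution Z rho ->
    {ae P, forall omega, forall i,
      freq R (initseg (Z omega) n) (evset (B i)) @[n --> \oo] -->
      fine (rho (cylinder (B i)))}.
  move=> se dZ; apply: ae_foralln => i.
  exact: (ae_distribution dZ (freq_cvg_ae (B i) se)).
have prob01 (rho : process R A) i : 0 <= fine (rho (cylinder (B i))) <= 1.
  have mB : measurable (cylinder (B i)) := measurable_shifted_event (B i) 0.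
  by rewrite -!lee_fin fineK ?fin_num_measure// measure_ge0 probability_le1.
have freqX := freqs _ _ rhox_se distX; have freqY := freqs _ _ rhoy_se distY.
split.
- apply: filterS2 freqX freqY => omega fX fY.
  apply: cvg_weighted_dist => //; try by move=> *; exact: freq_itv.
  + by move=> i; apply: cvg_comp (fX i); exact: cvg_fst.
  + by move=> i; apply: cvg_comp (fY i); exact: cvg_snd.
- apply: filterS freqX => omega fX.
  apply: cvg_weighted_dist => //; try by move=> *; exact: freq_itv.
  by move=> i; exact: cvg_cst.
Qed.
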